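(* Let $n$ and $k$ be integers with $1 \le k < n$, and let $A_1, A_2 \in \mathbb{R}^{n\times n}$. Then $A_1, A_2$ are simultaneously block triangularizable with dimension $k$ if and only if there exists an $(A_1,A_2)$-invariant $k$-dimensional subspace $W \subset \mathbb{R}^n$.
   Context: Matrices $A_1,\ldots,A_N \in \mathbb{R}^{n\times n}$ are called simultaneously block triangularizable with dimension $k$ (where $1\le k<n$) if there exists an invertible matrix $T \in \mathbb{R}^{n\times n}$ such that for every $i=1,\ldots,N$ $$T A_i T^{-1} = \begin{bmatrix} \tilde A_{i1} & \tilde A_{i2} \\ 0 & \tilde A_{i4}\end{bmatrix},$$ with $\tilde A_{i1} \in \mathbb{R}^{k\times k}$, $\tilde A_{i2}\in\mathbb{R}^{k\times(n-k)}$, $\tilde A_{i4}\in\mathbb{R}^{(n-k)\times(n-k)}$. A vector subspace $V\subset\mathbb{R}^n$ is called $(A_1,\ldots,A_N)$-invariant if $A_i v\in V$ for all $v\in V$ and all $i=1,\ldots,N$. *)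

(* Defs.v *)
From HB Require Import structures.
From mathcomp Require Import all_boot all_order all_algebra.
From mathcomp Require Import reals.

Set Implicit Arguments.
Unset Strict Implicit.
Unset Printing Implicit Defensive.

Import GRing.Theory.
Local Open Scope ring_scope.

(* The cast identifies 'M_(k + (n - k)) with 'M_n, so that the matrix can be
   written by blocks. *)
Definition block_uppertriangular_mx (R : realType) (n k : nat)
    (hkn : (k < n)%N) (B1 : 'M[R]_k) (B2 : 'M[R]_(k, n - k))
    (B4 : 'M[R]_(n - k)) : 'M[R]_n :=
  castmx (subnKC (ltnW hkn), subnKC (ltnW hkn)) (block_mx B1 B2 0 B4).

Definition simultaneously_block_triangularizable (R : realType) (N n k : nat)
    (hkn : (k < n)%N) (A : N.-tuple 'M[R]_n) : Prop :=
  exists2 T : 'M[R]_n, T \in unitmx &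
    forall i : 'I_N,
      exists (B1 : 'M[R]_k) (B2 : 'M[R]_(k, n - k)) (B4 : 'M[R]_(n - k)),
        T *m tnth A i *m invmx T = block_uppertriangular_mx hkn B1 B2 B4.

Definition invariant_subspace (R : realType) (N n : nat)
    (A : N.-tuple 'M[R]_n) (V : {vspace 'cV[R]_n}) : Prop :=
  forall (i : 'I_N) (v : 'cV[R]_n), v \in V -> tnth A i *m v \in V.

(* Main.v *)
Require Import Defs.
From HB Require Import structures.
From mathcomp Require Import all_boot all_order all_algebra.
From mathcomp Require Import reals.

Set Implicit Arguments.
Unset Strict Implicit.
Unset Printing Implicit Defensive.

Import GRing.Theory.
Local Open Scope ring_scope.

(** Both conditions say the same thing about an injective matrix [B] of size
    n x k: that [A *m B = B *m C] has a solution [C] for each [A] in the family.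

    If [T *m A *m invmx T] is block triangular, then reading off the first [k]
    columns of [A *m invmx T = invmx T *m U] shows that the first [k] columns
    [B] of [invmx T] satisfy such an equation, and conversely
    ([block_triangular_first_colsP]).  On the other side, [A *m B = B *m C] means
    that the column space of [B] is stable under [A] ([colspace_stableP]).

    It remains to pass between [B], [T] and [W].  The first [k] columns of an
    invertible matrix form an injective [B] ([first_cols_row_free]), and every
    injective [B] arises so, since its columns extend to a basis of the whole
    space ([row_free_complete]).  The column space of an injective [B] has
    dimension [k] ([dim_colspace]), and every [k]-dimensional space is of this
    form ([colspace_of_dim]).  None of these choices depends on the matrices [A],
    so the equivalence holds for a family of any length. *)

Definition colspace (F : fieldType) (n k : nat) (B : 'M[F]_(n, k)) :
    {vspace 'cV[F]_n} :=
  limg (linfun (mulmx B : 'cV[F]_k -> 'cV[F]_n)).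

Lemma colspaceP (F : fieldType) (n k : nat) (B : 'M[F]_(n, k)) (v : 'cV[F]_n) :
  reflect (exists x : 'cV[F]_k, v = B *m x) (v \in colspace B).
Proof.
apply: (iffP memv_imgP) => [[x _ ->]|[x ->]]; exists x; rewrite ?lfunE //.
exact: memvf.
Qed.

(** The columns of [C] are the coordinates, with respect to the columns of [B],
    of the images under [A] of the columns of [B]. *)
Lemma colspace_stableP (F : fieldType) (n k : nat) (A : 'M[F]_n)
    (B : 'M[F]_(n, k)) :
  (forall v, v \in colspace B -> A *m v \in colspace B) <->
  exists C : 'M[F]_k, A *m B = B *m C.
Proof.
split=> [stabB | [C AB_BC] v /colspaceP[x ->]]; last first.
  by apply/colspaceP; exists (C *m x); rewrite !mulmxA AB_BC.
have /fin_all_exists[c Ec] (j : 'I_k) : exists x, A *m col j B = B *m x.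
  by apply/colspaceP/stabB/colspaceP; exists (delta_mx j 0); rewrite colE.
exists (\matrix_(i, j) c j i 0); apply/matrixP => i j.
have /matrixP/(_ i 0) := Ec j; rewrite !mxE => Eij.
transitivity (\sum_l A i l * col j B l 0).
  by apply: eq_bigr => l _; rewrite mxE.
by rewrite Eij; apply: eq_bigr => l _; rewrite mxE.
Qed.

Lemma dim_colspace (F : fieldType) (n k : nat) (B : 'M[F]_(n, k)) :
  row_free B^T -> \dim (colspace B) = k.
Proof.
move=> freeB; rewrite /colspace limg_dim_eq.
  by rewrite dimvf; apply: muln1.
apply/eqP; rewrite -subv0; apply/subvP => x.
rewrite memv_cap memv_ker lfunE /= memv0 => /andP[_ /eqP Bx0].
rewrite -trmx_eq0; apply/eqP/(row_free_inj freeB).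
by rewrite mul0mx -trmx_mul Bx0 trmx0.
Qed.

Lemma colspace_of_dim (F : fieldType) (n k : nat) (W : {vspace 'cV[F]_n}) :
  \dim W = k ->
  exists2 B : 'M[F]_(n, k), row_free B^T & colspace B = W.
Proof.
move=> <-; pose b := vbasis W.
have bW : basis_of W b := vbasisP W.
pose B : 'M[F]_(n, \dim W) := \matrix_(i, j) b`_j i 0.
have mulB (x : 'cV[F]_(\dim W)) : B *m x = \sum_j x j 0 *: b`_j.
  apply/matrixP => i j; rewrite ord1 !mxE summxE.
  by apply: eq_bigr => l _; rewrite !mxE mulrC.
exists B.
  apply: inj_row_free => y /(congr1 trmx).
  rewrite trmx_mul trmxK trmx0 mulB => y0; apply/matrixP => i j.
  have /freeP/(_ (fun j => y^T j 0) y0 j) := basis_free bW.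
  by rewrite !mxE ord1.
apply/vspaceP => v; apply/colspaceP/idP => [[x ->] | Wv].
  rewrite mulB; apply: memv_suml => j _; apply: memvZ.
  by apply/vbasis_mem/mem_nth; rewrite size_tuple.
exists (\col_j coord b j v); rewrite mulB {1}(coord_basis bW Wv).
by apply: eq_bigr => j _; rewrite mxE.
Qed.

Definition first_cols (F : fieldType) (k m n : nat) (e : (k + m)%N = n)
    (P : 'M[F]_n) : 'M[F]_(n, k) :=
  lsubmx (castmx (erefl n, esym e) P).

Lemma first_cols_row_free (F : fieldType) (k m n : nat) (e : (k + m)%N = n)
    (P : 'M[F]_n) :
  P \in unitmx -> row_free (first_cols e P)^T.
Proof.
case: _ / e P => P Punit; rewrite /first_cols castmx_id.
(* The first [k] rows of [invmx P] form a left inverse of the first [k] columns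
   of [P]. *)
apply/row_freeP; exists (usubmx (invmx P))^T.
rewrite -trmx_mul mulmx_lsub mul_usub_mx mulVmx //.
by rewrite scalar_mx_block block_mxEv col_mxKu row_mxKl trmx1.
Qed.

(** Gaussian elimination writes [B] as [L *m pid_mx k *m U] with [L] and [U]
    invertible, and [pid_mx k] keeps the first [k] columns of [L].  These span
    the column space of [B], so [L] is already a completed basis up to the
    change of basis [U] among its first [k] columns. *)
Lemma row_free_complete (F : fieldType) (k m n : nat) (e : (k + m)%N = n)
    (B : 'M[F]_(n, k)) :
  row_free B^T -> exists2 P : 'M[F]_n, P \in unitmx & first_cols e P = B.
Proof.
case: _ / e B => B; rewrite /row_free mxrank_tr => /eqP rankB.
exists (col_ebase B *m block_mx (row_ebase B) 0 0 1%:M).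
  by rewrite unitmx_mul col_ebase_unit unitmxE det_ublock det1 mulr1
             -unitmxE row_ebase_unit.
rewrite /first_cols castmx_id -mulmx_lsub -[RHS]mulmx_ebase -mulmxA.
congr (_ *m _); rewrite rankB pid_mx_col mul_col_mx mul1mx mul0mx.
by rewrite block_mxEh row_mxKl.
Qed.

(** The equality [e] is a variable so that the casts disappear once [e] is
    eliminated. *)
Lemma block_triangular_first_colsP (F : fieldType) (k m n : nat)
    (e : (k + m)%N = n) (A T : 'M[F]_n) :
  T \in unitmx ->
  (exists (B1 : 'M[F]_k) (B2 : 'M[F]_(k, m)) (B4 : 'M[F]_m),
     T *m A *m invmx T = castmx (e, e) (block_mx B1 B2 0 B4)) <->
  exists C : 'M[F]_k,
    A *m first_cols e (invmx T) = first_cols e (invmx T) *m C.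
Proof.
rewrite /first_cols; case: _ / e A T => A T Tunit; rewrite castmx_id /=; split.
  move=> [B1 [B2 [B4]]]; rewrite castmx_id => TAT; exists B1.
  have AP : A *m invmx T = invmx T *m block_mx B1 B2 0 B4.
    by rewrite -TAT -!mulmxA mulKmx.
  rewrite mulmx_lsub AP -mulmx_lsub block_mxEh row_mxKl.
  by rewrite -{1}[invmx T]hsubmxK mul_row_col mulmx0 addr0.
move=> [C AB]; set U := T *m A *m invmx T.
exists (ulsubmx U), (ursubmx U), (drsubmx U); rewrite castmx_id.
(* The first columns of [T *m invmx T] are those of the identity, so those of
   [U] are [C] above [0]. *)
have lU : lsubmx U = col_mx C 0.
  rewrite -mulmx_lsub -mulmxA AB mulmxA mulmx_lsub mulmxV //.
  by rewrite scalar_mx_block block_mxEh row_mxKl mul_col_mx mul1mx mul0mx.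
have <- : dlsubmx U = 0.
  rewrite -(col_mxKd C 0) -lU; apply/matrixP => i j.
  by rewrite !mxE.
by rewrite submxK.
Qed.

Lemma simultaneously_block_triangularizableP (R : realType) (N n k : nat)
    (hkn : (k < n)%N) (A : N.-tuple 'M[R]_n) :
  simultaneously_block_triangularizable hkn A <->
  exists W : {vspace 'cV[R]_n}, invariant_subspace A W /\ \dim W = k.
Proof.
pose e := subnKC (ltnW hkn).
split=> [[T Tunit TA] | [W [stabW dimW]]].
  exists (colspace (first_cols e (invmx T))); split.
    move=> i; apply/colspace_stableP.
    exact/(block_triangular_first_colsP e _ Tunit)/TA.
  by apply/dim_colspace/first_cols_row_free; rewrite unitmx_inv.
have [B freeB defW] := colspace_of_dim dimW.
have [P Punit defB] := row_free_complete e freeB.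
have Tunit : invmx P \in unitmx by rewrite unitmx_inv.
exists (invmx P) => // i; apply/(block_triangular_first_colsP e _ Tunit).
by rewrite invmxK defB; apply/colspace_stableP; rewrite defW; apply: stabW.
Qed.

Theorem theorem1 (R : realType) (n k : nat) (hk : (1 <= k)%N) (hkn : (k < n)%N)
    (A1 A2 : 'M[R]_n) :
  simultaneously_block_triangularizable hkn [tuple A1; A2] <->
  exists W : {vspace 'cV[R]_n},
    invariant_subspace [tuple A1; A2] W /\ \dim W = k.
Proof. exact: simultaneously_block_triangularizableP. Qed.
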